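(* Let $\eta>0$ and $M_\eta>0$. There is a scalar $c\in\mathbb{R}$ (depending only on $\eta$ and $M_\eta$) such that, for all log-concave probability measures $\mu,\nu$ on $\mathbb{R}^d$ both satisfying the tail assumption with constants $(\eta,M_\eta)$, $$\mathrm{W}_2(\mu,\nu)\le c\,d\,\max\left(\log\left(\frac{1}{\|\mu-\nu\|_{\mathrm{TV}}}\right),1\right)\sqrt{\|\mu-\nu\|_{\mathrm{TV}}},$$ where the right-hand side is read as $0$ when $\|\mu-\nu\|_{\mathrm{TV}}=0$.
   Context: A probability measure $d\mu\propto e^{-f(x)}dx$ on $\mathbb{R}^d$ is log-concave if $f:\mathbb{R}^d\to\mathbb{R}$ is convex. Tail assumption with constants $(\eta,M_\eta)$ for $d\mu\propto e^{-f}dx$: for all $x\in\mathbb{R}^d$ with $\|x\|_2\ge M_\eta$, $f(x)-f(x^* )\ge\eta\|x-x^*\|_2$, where $x^*=\arg\min f$; by convention $x^*=0$ and $f(x^* )=0$ throughout. $\|\mu-\nu\|_{\mathrm{TV}}=\sup_S|\mu(S)-\nu(S)|$ over measurable $S$; $\mathrm{W}_2^2(\mu,\nu)=\inf_\phi\int\|x-y\|_2^2\,d\phi(x,y)$ over couplings $\phi$ of $\mu,\nu$. *)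

(* Defs.v *)
From HB Require Import structures.
From mathcomp Require Import all_boot all_order all_algebra.
From mathcomp Require Import all_classical all_reals all_analysis.

Set Implicit Arguments.
Unset Strict Implicit.
Unset Printing Implicit Defensive.

Import Order.TTheory GRing.Theory Num.Theory.
Import numFieldNormedType.Exports.

Local Open Scope classical_set_scope.
Local Open Scope ring_scope.

(* R^d is 'rV[R]_d; its Borel sigma-algebra is
   generated by the coordinates, as the library does for tuples. *)
Section measurable_rV.
Context (R : realType) (d : nat).

Let coord (i : 'I_d) (x : 'rV[R]_d) : R := x ord0 i.

Let rV_set0 : g_sigma_preimage coord set0.
Proof. exact: sigma_algebra0. Qed.

Let rV_setC A : g_sigma_preimage coord A -> g_sigma_preimage coord (~` A).
Proof. exact: sigma_algebraC. Qed.

Let rV_bigcup (F : _^nat) : (forall i, g_sigma_preimage coord (F i)) ->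
  g_sigma_preimage coord (\bigcup_i (F i)).
Proof. exact: sigma_algebra_bigcup. Qed.

HB.instance Definition _ := @isMeasurable.Build default_measure_display
  'rV[R]_d (g_sigma_preimage coord) rV_set0 rV_setC rV_bigcup.

Lemma measurable_coord (i : 'I_d) :
  measurable_fun [set: 'rV[R]_d] (fun x : 'rV[R]_d => x ord0 i).
Proof.
move=> _ Y mY; rewrite setTI; apply: sub_sigma_algebra => /=.
rewrite -bigcup_seq/=; exists i => /=; first by rewrite mem_index_enum.
by exists Y => //; rewrite setTI.
Qed.

Lemma measurable_fun_coordP d' (T : measurableType d') (f : T -> 'rV[R]_d) :
  (forall i, measurable_fun [set: T] (fun t => f t ord0 i)) ->
  measurable_fun [set: T] f.
Proof.
move=> mf _ A mA; rewrite setTI.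
suff : g_sigma_preimage (fun i => coord i \o f) `<=` measurable.
  by rewrite g_sigma_preimage_comp; apply; exists A => //; rewrite setTI.
apply: smallest_sub; first exact: sigma_algebra_measurable.
rewrite -bigcup_seq/=; apply: bigcup_sub => i _ _ [B mB <-].
exact: mf.
Qed.

End measurable_rV.

Section lebesgue_rV.
Context {R : realType}.

Definition cons_rV d (p : R * 'rV[R]_d) : 'rV[R]_d.+1 :=
  row_mx (const_mx p.1 : 'rV[R]_1) p.2.

Lemma cons_rV0 d (p : R * 'rV[R]_d) : cons_rV p ord0 ord0 = p.1.
Proof.
rewrite /cons_rV (_ : ord0 = lshift d ord0 :> 'I_(1 + d)); last exact/val_inj.
exact: (etrans (row_mxEl _ _ _ _) (mxE _ _ _ _)).
Qed.

Lemma cons_rVS d (p : R * 'rV[R]_d) (i : 'I_d) :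
  cons_rV p ord0 (lift ord0 i) = p.2 ord0 i.
Proof.
have -> : lift ord0 i = rshift 1 i :> 'I_d.+1 by exact/val_inj.
exact: row_mxEr.
Qed.

Lemma measurable_cons_rV d :
  measurable_fun [set: measurableTypeR R * 'rV[R]_d] (@cons_rV d).
Proof.
apply: measurable_fun_coordP => i; case: (unliftP ord0 i) => [j|] ->.
  under eq_fun do rewrite cons_rVS.
  exact: (measurableT_comp (measurable_coord j) measurable_snd).
by under eq_fun do rewrite cons_rV0; exact: measurable_fst.
Qed.

Section lebesgue_cons.
Context d (m : {measure set 'rV[R]_d -> \bar R}).

Definition lebesgue_cons : set 'rV[R]_d.+1 -> \bar R :=
  pushforward (lebesgue_measure \x^ m)%E (@cons_rV d).

HB.instance Definition _ := Measure.copy lebesgue_cons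
  (measure_function_pushforward__canonical__measure_function_Measure
    (lebesgue_measure \x^ m)%E (@measurable_cons_rV d)).

End lebesgue_cons.

(* Built as an iterated product because the library has Lebesgue measure only
   on the line; lebesgue_rV_box pins it down on boxes. *)
Fixpoint lebesgue_rV d : {measure set 'rV[R]_d -> \bar R} :=
  if d is d'.+1 then lebesgue_cons (lebesgue_rV d') else dirac (0 : 'rV[R]_0).

Lemma lebesgue_rV_box d (a b : 'I_d -> R) : (forall i, a i <= b i) ->
  lebesgue_rV d [set x | forall i, x ord0 i \in `[a i, b i]] =
  (\prod_(i < d) (b i - a i))%:E.
Proof.
elim: d a b => [|d ih] a b ab.
  by rewrite big_ord0 /= diracE mem_set// => -[].
rewrite /= /lebesgue_cons /pushforward.
pose B := [set x : 'rV[R]_d |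
  forall i, x ord0 i \in `[a (lift ord0 i), b (lift ord0 i)]].
rewrite (_ : _ @^-1` _ = `[a ord0, b ord0] `*` B); last first.
  apply/seteqP; split => [[r x] /= xab|[r x] /= [rab xab] i].
    split=> [|i].
      by have := xab ord0; rewrite cons_rV0.
    by have := xab (lift ord0 i); rewrite cons_rVS.
  by case: (unliftP ord0 i) => [j|] ->; rewrite ?cons_rVS ?cons_rV0.
have mB : measurable B.
  rewrite (_ : B = \bigcap_(i in [set` enum 'I_d])
    (fun x : 'rV[R]_d => x ord0 i) @^-1`
      `[a (lift ord0 i), b (lift ord0 i)]); last first.
    apply/seteqP; split => x /= xB i; first by move=> _; exact: xB.
    by apply: xB; rewrite /= mem_enum.
  apply: fin_bigcap_measurable => // i _; rewrite -[X in measurable X]setTI.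
  by apply: measurable_coord.
rewrite product_measure2E//= ih// big_ord_recl EFinM lebesgue_measure_itv/=.
congr (_ * _)%E; rewrite lte_fin; case: ltP => // ba.
by rewrite (@le_anti _ _ (a ord0) (b ord0)) ?subrr// ab.
Qed.

End lebesgue_rV.

Section log_concave_distances.
Context {R : realType} {d : nat}.
Implicit Types (f : 'rV[R]_d -> R) (mu nu : probability 'rV[R]_d R).

(* Needed since the library's norm on matrices is the sup norm. *)
Definition norm2 (x : 'rV[R]_d) : R := Num.sqrt (\sum_(i < d) x ord0 i ^+ 2).

(* d mu \propto exp(-f(x)) dx; k is the inverse of the normalizing constant. *)
Definition has_potential mu f : Prop :=
  exists2 k : R, 0 < k & forall A, measurable A ->
    mu A = (k%:E * \int[lebesgue_rV d]_(x in A) (expR (- f x))%:E)%E.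

Definition log_concave mu f : Prop :=
  convex_function [set: convex_lmodType 'rV[R]_d] f /\ has_potential mu f.

Definition minimizer f (xs : 'rV[R]_d) : Prop := forall x, f xs <= f x.

Definition tail_assumption (eta M : R) f (xs : 'rV[R]_d) : Prop :=
  minimizer f xs /\
  forall x, M <= norm2 x -> eta * norm2 (x - xs) <= f x - f xs.

Definition tv_dist mu nu : R :=
  sup [set `|fine (mu S) - fine (nu S)| | S in measurable].

Definition coupling mu nu
    (phi : probability ('rV[R]_d * 'rV[R]_d)%type R) : Prop :=
  forall A, measurable A ->
    phi (fst @^-1` A) = mu A /\ phi (snd @^-1` A) = nu A.

Definition W2 mu nu : \bar R :=
  (ereal_inf [set \int[phi]_z (norm2 (z.1 - z.2) ^+ 2)%:E
             | phi in coupling mu nu] `^ 2^-1)%E.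

End log_concave_distances.

(* Main.v *)
Require Import Defs.
From HB Require Import structures.
From mathcomp Require Import all_boot all_order all_algebra.
From mathcomp Require Import all_classical all_reals all_analysis.
From mathcomp Require Import measurable_realfun ring lra.

Import Order.TTheory GRing.Theory Num.Theory.
Import numFieldNormedType.Exports.

Local Open Scope classical_set_scope.
Local Open Scope ring_scope.
Set Implicit Arguments.
Unset Strict Implicit.
Unset Printing Implicit Defensive.

(** Write tv for the total variation distance, mu = kap + rho1 and
    nu = kap + rho2 with kap the common part of the two laws; rho1 and rho2 both
    have mass at most tv.  Leaving kap in place and transporting rho1 to rho2 by
    the normalized product costs at most twice the sum of the second moments of
    rho1 and rho2 ([common_part], [W2_le_second_moments]).  It remains to see
    that a piece of mass at most tv of a log-concave law has second moment of
    order (d L)^2 tv, where L = max (log (1/tv)) 1.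

    The tail of a log-concave law mu with potential f, f 0 = 0, comes from
    dilating by 2: convexity gives f (x / 2) <= f x / 2, so the integral of
    exp (- f / 2) is at most that of exp (- f (x / 2)), which is 2^d times
    that of exp (- f).  Hence the mean of exp (f / 2) under mu is at most 2^d
    ([integral_expR_half_potential]).  The tail assumption gives
    eta |x| <= f x + eta M for every x, so exp (eta |x| / 2) has mean at most
    K = exp (eta M / 2) 2^d ([integral_expR_norm2]).

    For any a >= 0 and y >= 0, y^2 <= 2 a^2 + 8 exp (y - a).  Integrating this
    with y = eta |x| / 2 against rho1 <= mu and choosing a = ln K + L bounds the
    second moment by (2 a^2 + 8) tv / (eta / 2)^2 ([integral_norm2_sqr_le]).  As
    ln K is affine in d, a is at most a constant times d L.

    Two facts on R^d are needed on the way: the scaling of Lebesgue measure under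
    dilations ([lebesgue_rV_scale]), and the Borel measurability of convex
    functions ([measurable_jensen]), which lets integrals against mu be computed
    from the density exp (- f). *)

(** * Measurability of convex functions *)

Section cons_rV_linear.
Context {R : realType} {d : nat}.

Lemma cons_rVZ (a r : R) (x : 'rV[R]_d) :
  a *: cons_rV (r, x) = cons_rV (a * r, a *: x).
Proof.
apply/rowP => i; rewrite [LHS]mxE.
by case: (unliftP ord0 i) => [j|] ->; rewrite ?cons_rVS ?cons_rV0//= mxE.
Qed.

Lemma cons_rVD (r s : R) (x y : 'rV[R]_d) :
  cons_rV (r, x) + cons_rV (s, y) = cons_rV (r + s, x + y).
Proof.
apply/rowP => i; rewrite [LHS]mxE.
by case: (unliftP ord0 i) => [j|] ->; rewrite ?cons_rVS ?cons_rV0//= mxE.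
Qed.

End cons_rV_linear.

Section convex_measurable.
Context {R : realType}.

(** The weight is a plain scalar, unlike in convex spaces, so that the inequality
    can be transported along affine maps by computation. *)
Definition jensen (E : lmodType R) (f : E -> R) : Prop :=
  forall t x y, 0 <= t -> t <= 1 ->
    f (t *: x + (1 - t) *: y) <= t * f x + (1 - t) * f y.

Lemma convex_jensen (E : lmodType R) (f : E -> R) :
  convex_function [set: convex_lmodType E] f -> jensen f.
Proof.
move=> cf t x y t0 t1.
exact: (cf (Itv01 t0 t1) x y (in_setT _) (in_setT _)).
Qed.

Lemma jensen_segment (E : lmodType R) (f : E -> R) (x y : E) :
  jensen f -> jensen (fun s : R^o => f (x + s *: y)).
Proof.
move=> cf t r s t0 t1; set lhs := (X in f X).
rewrite (_ : lhs = t *: (x + r *: y) + (1 - t) *: (x + s *: y)); first exact: cf.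
rewrite /lhs !scalerDr addrACA -scalerDl [t + _]addrC subrK scale1r.
by rewrite [in LHS](scalerDl y (t *: r)) !scalerA.
Qed.

(** The values to the right of r lie under the chord from r to r + 1, which
    starts at phi r < a and has bounded slope. *)
Lemma jensen_right_nbhs (phi : R^o -> R) (a r : R) : jensen phi -> phi r < a ->
  exists2 e : R, 0 < e & forall s : R, r < s -> s < r + e -> phi s < a.
Proof.
move=> cphi ra; set b := phi (r + 1).
pose e := Num.min 1 ((a - phi r) / (`|b - phi r| + 1)).
have den : 0 < `|b - phi r| + 1 by rewrite ltr_wpDl.
have e0 : 0 < e by rewrite lt_min ltr01 divr_gt0// subr_gt0.
exists e => // s rs se; set t := s - r.
have t0 : 0 < t by rewrite subr_gt0.
have te : t < e by rewrite ltrBlDl.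
have t1 : t < 1 by rewrite (lt_le_trans te)// ge_min lexx.
have tq : t * (`|b - phi r| + 1) < a - phi r.
  by rewrite -ltr_pdivlMr// (lt_le_trans te)// ge_min lexx orbT.
have := cphi t (r + 1) r (ltW t0) (ltW t1).
rewrite (_ : t *: _ + _ *: _ = s); last first.
  rewrite [LHS]/(t * (r + 1) + (1 - t) * r).
  have key (u v w : R) : u = v - w -> u * (w + 1) + (1 - u) * w = v by move=> ->; ring.
  exact: key.
move=> /le_lt_trans; apply; rewrite -/b.
have : t * (b - phi r) <= t * `|b - phi r|.
  by rewrite ler_pM2l// ler_norm.
by nra.
Qed.

Lemma jensen_left_nbhs (phi : R^o -> R) (a r : R) : jensen phi -> phi r < a ->
  exists2 e : R, 0 < e & forall s : R, r - e < s -> s < r -> phi s < a.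
Proof.
move=> cphi ra; have cN : jensen (phi \o -%R : R^o -> R).
  by move=> t x y t0 t1 /=; rewrite opprD -!scalerN; exact: cphi.
have [|e e0 he] := @jensen_right_nbhs _ a (- r) cN; first by rewrite /= opprK.
exists e => // s res sr; have /= := he (- s); rewrite opprK; apply.
  by rewrite ltrN2.
by rewrite -ltrN2 opprD !opprK.
Qed.

Lemma jensen_interval (phi : R^o -> R) (a p q r : R) : jensen phi ->
  p < r -> r < q -> phi p < a -> phi q < a -> phi r < a.
Proof.
move=> cphi pr rq pa qa; set t := (q - r) / (q - p).
have qp : 0 < q - p by rewrite subr_gt0 (lt_trans pr).
have t0 : 0 < t by rewrite divr_gt0// subr_gt0.
have t1 : t < 1 by rewrite /t ltr_pdivrMr// mul1r ltrD2l ltrN2.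
have := cphi t p q (ltW t0) (ltW t1).
rewrite (_ : t *: _ + _ *: _ = r); last first.
  have key (u : R) : u * (q - p) = q - r -> u * p + (1 - u) * q = r.
    move=> uE; rewrite (_ : _ + _ = q - u * (q - p)); last by ring.
    by rewrite uE subKr.
  by apply: key; rewrite /t divfK// gt_eqF.
by move=> /le_lt_trans; apply; nra.
Qed.

(** By induction on the dimension.  With x fixed the function r |-> f (r, x) is
    convex, so f (r, x) < a iff f (p, x) < a and f (q, x) < a for some rationals
    p < r < q.  A strict sublevel set is thus a countable union of measurable
    rectangles, whose second factors are measurable by induction. *)
Lemma measurable_jensen d (f : 'rV[R]_d -> R) :
  jensen f -> measurable_fun [set: 'rV[R]_d] f.
Proof.
elim: d f => [|d ih] f cf.
  rewrite (_ : f = cst (f 0)); first exact: measurable_cst.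
  by apply/funext => x; rewrite /= (_ : x = 0)//; apply/rowP => -[].
pose g (p : measurableTypeR R * 'rV[R]_d) := f (cons_rV p).
pose h (x : 'rV[R]_d.+1) : measurableTypeR R * 'rV[R]_d :=
  (x ord0 ord0, \row_i x ord0 (lift ord0 i)).
have gh : f = g \o h.
  apply/funext => x; congr f; apply/rowP => i.
  by case: (unliftP ord0 i) => [j|] ->; rewrite ?cons_rVS ?cons_rV0//= mxE.
have mh : measurable_fun setT h.
  apply/measurable_fun_pairP; split; first exact: measurable_coord.
  apply: measurable_fun_coordP => i /=.
  by under eq_fun do rewrite mxE; exact: measurable_coord.
suff mg : measurable_fun setT g by rewrite gh; exact: measurableT_comp.
have cr r : jensen (fun x => f (cons_rV (r, x))).
  move=> t x y t0 t1; set lhs := (X in f X).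
  rewrite (_ : lhs = t *: cons_rV (r, x) + (1 - t) *: cons_rV (r, y)).
    exact: cf.
  rewrite !cons_rVZ cons_rVD /lhs; congr (cons_rV (_, _)).
  by rewrite mulrBl mul1r addrC subrK.
have cx x : jensen (fun r : R^o => f (cons_rV (r, x))).
  rewrite (_ : (fun _ => _) =
    fun r : R^o => f (cons_rV (0, x) + r *: cons_rV (1, 0))); last first.
    by apply/funext => r; rewrite cons_rVZ cons_rVD mulr1 scaler0 add0r addr0.
  exact: jensen_segment.
move=> mT; apply: (measurability _ (RGenInftyO.measurableE R)) => //.
move=> _ [_ [a ->] <-]; rewrite setTI.
pose S (p q : rat) := `](ratr p : R), (ratr q : R)[%classic `*`
  ([set x | f (cons_rV (ratr p, x)) < a] `&`
   [set x | f (cons_rV (ratr q, x)) < a]).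
have mlt r : measurable [set x | f (cons_rV (r, x)) < a].
  rewrite -[X in measurable X]setTI.
  have := ih _ (cr r) measurableT _ (@measurable_itv R `]-oo, a[).
  by rewrite (_ : _ @^-1` _ = [set x | f (cons_rV (r, x)) < a])//;
    apply/seteqP; split => x /=; rewrite in_itv.
rewrite (_ : _ @^-1` _ = \bigcup_p \bigcup_q S p q).
  apply: bigcupT_measurable_rat => p; apply: bigcupT_measurable_rat => q.
  apply: measurableX; first exact: measurable_itv.
  by apply: measurableI; exact: mlt.
apply/seteqP; split => [[r x] /=|[r x] [p _ [q _] [/=]]].
  rewrite in_itv/= /g => rxa.
  have [e e0 he] := jensen_left_nbhs (cx x) rxa.
  have [e' e'0 he'] := jensen_right_nbhs (cx x) rxa.
  have [p] : exists p, ratr p \in `]r - e, r[.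
    by apply: rat_in_itvoo; rewrite gtrBl.
  have [q] : exists q, ratr q \in `]r, r + e'[.
    by apply: rat_in_itvoo; rewrite ltrDl.
  rewrite !in_itv/= => /andP[rq qr] /andP[rp pr].
  exists p => //; exists q => //; split => /=.
    by rewrite in_itv/= pr rq.
  by split; [exact: he|exact: he'].
rewrite !in_itv/= => /andP[pr rq] [px qx].
exact: (jensen_interval (cx x) pr rq px qx).
Qed.

End convex_measurable.

(** * Densities and dilations *)

Section change_of_variables.
Local Open Scope ereal_scope.
Import HBNNSimple.

Lemma ge0_integral_image d1 d2 (T1 : measurableType d1) (T2 : measurableType d2)
    (R : realType) (m1 : {measure set T1 -> \bar R})
    (m2 : {measure set T2 -> \bar R}) (phi : T1 -> T2) (g : T2 -> \bar R) :
  measurable_fun setT phi ->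
  (forall A, measurable A -> m1 (phi @^-1` A) = m2 A) ->
  measurable_fun setT g -> (forall y, 0 <= g y) ->
  \int[m1]_x g (phi x) = \int[m2]_y g y.
Proof.
move=> mphi m12 mg g0.
transitivity (\int[pushforward m1 phi]_y g y).
  by rewrite ge0_integral_pushforward//= => y _; exact: g0.
apply: (@eq_measure_integral _ _ _ _ m2
  (measure_function_pushforward__canonical__measure_function_Measure m1 mphi)).
by move=> A mA _; exact: m12.
Qed.

(** The indicator case is the definition of a density; the general case follows
    by linearity and monotone convergence. *)
Lemma ge0_integral_density d (T : measurableType d) (R : realType)
    (m nu : {measure set T -> \bar R}) (p : T -> R) (h : T -> \bar R) :
  measurable_fun setT p -> (forall x, 0 <= p x)%R ->
  measurable_fun setT h -> (forall x, 0 <= h x) ->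
  (forall A, measurable A -> nu A = \int[m]_(x in A) (p x)%:E) ->
  \int[nu]_x h x = \int[m]_x (h x * (p x)%:E).
Proof.
move=> mp p0 mh h0 nuE.
have mpE : measurable_fun setT (EFin \o p) by exact/measurable_EFinP.
have pE0 x : 0 <= (p x)%:E by rewrite lee_fin.
pose h_ := nnsfun_approx measurableT mh.
have mh_ n : measurable_fun setT (fun x => (h_ n x)%:E).
  exact/measurable_EFinP/measurable_funP.
have hE x : h x = limn (fun n => (h_ n x)%:E).
  by apply/esym/cvg_lim => //; apply: cvg_nnsfun_approx => // y _; exact: h0.
have nd x : nondecreasing_seq (fun n => (h_ n x)%:E).
  by move=> i j ij; rewrite lee_fin; exact/lefP/nd_nnsfun_approx.
transitivity (limn (fun n => \int[nu]_x (h_ n x)%:E)).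
  rewrite -monotone_convergence//.
  - by apply: eq_integral => x _; rewrite hE.
  - by move=> n x _; rewrite lee_fin.
transitivity (limn (fun n => \int[m]_x ((h_ n x)%:E * (p x)%:E))); last first.
  rewrite -monotone_convergence//.
  - apply: eq_integral => x _; apply/cvg_lim => //.
    apply: cvgeZr => //.
    apply: cvg_nnsfun_approx => // y _; exact: h0.
  - by move=> n; exact: emeasurable_funM.
  - by move=> n x _; rewrite mule_ge0// lee_fin.
  - by move=> x _ i j ij; rewrite lee_wpmul2r//; exact: nd.
congr (limn _); apply/funext => n.
transitivity (\sum_(k \in range (h_ n))
    \int[nu]_x (k * \1_(h_ n @^-1` [set k]) x)%:E).
  rewrite -ge0_integral_fsum//; last 2 first.
  - by move=> r; exact/measurable_EFinP/measurable_funM.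
  - by move=> r x _; rewrite nnfun_muleindic_ge0.
  by apply: eq_integral => x _; rewrite fsumEFin// -fimfunE.
transitivity (\sum_(k \in range (h_ n))
    \int[m]_x ((k * \1_(h_ n @^-1` [set k]) x)%:E * (p x)%:E)); last first.
  rewrite -ge0_integral_fsum//; last 2 first.
  - move=> r; apply: emeasurable_funM => //.
    exact/measurable_EFinP/measurable_funM.
  - by move=> r x _; rewrite mule_ge0// nnfun_muleindic_ge0.
  apply: eq_integral => x _; rewrite -ge0_mule_fsuml; last first.
    by move=> r; rewrite nnfun_muleindic_ge0.
  by rewrite fsumEFin// -fimfunE.
apply: eq_fsbigr => r /[!inE] -[x _ rE].
have r0 : (0 <= r)%R by rewrite -rE.
have mr : measurable (h_ n @^-1` [set r]) by exact: measurable_sfunP.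
under eq_integral do rewrite EFinM.
under [RHS]eq_integral do rewrite EFinM -muleA.
rewrite !ge0_integralZl//; last 3 first.
- apply: emeasurable_funM => //; exact/measurable_EFinP.
- by move=> y _; rewrite mule_ge0// lee_fin.
- exact/measurable_EFinP.
congr (_ * _).
rewrite integral_indic// setIT nuE// integral_mkcond.
apply: eq_integral => y _; rewrite patchE indicE.
by case: ifPn => _; rewrite ?mul1e ?mul0e.
Qed.

Lemma lebesgue_measure_scale (R : realType) (a : R) (A : set R) : (0 < a)%R ->
  measurable A ->
  lebesgue_measure (( *%R a : measurableTypeR R -> measurableTypeR R) @^-1` A) =
  (a^-1)%:E * lebesgue_measure A.
Proof.
move=> a0 mA.
have ma : measurable_fun setT ( *%R a : measurableTypeR R -> measurableTypeR R).
  exact: mulrl_measurable.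
pose la := @lebesgue_measure R.
pose m : {measure set _ -> \bar R} := mscale (NngNum (ltW a0))
  (measure_function_pushforward__canonical__measure_function_Measure la ma).
suff -> : lebesgue_measure A = m A.
  rewrite /m /= /mscale /= /pushforward muleA -EFinM mulVf ?gt_eqF//.
  by rewrite mul1e.
apply: lebesgue_measure_unique => // _ [[x y]] _ <-.
rewrite /m /= /mscale /= /pushforward.
rewrite (_ : _ @^-1` _ = `](x / a)%R, (y / a)%R]%classic); last first.
  apply/seteqP; split => z /=; rewrite !in_itv/=;
    by rewrite ltr_pdivrMr// ler_pdivlMr// mulrC.
rewrite /la !lebesgue_measure_itv/= !lte_fin ltr_pM2r ?invr_gt0//.
case: ifPn => _; last by rewrite mule0.
by rewrite -!EFinB -EFinM; congr EFin; field; rewrite gt_eqF.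
Qed.

Lemma measurable_scale_rV (R : realType) d (a : R) :
  measurable_fun setT (fun x : 'rV[R]_d => (a *: x)%R).
Proof.
apply: measurable_fun_coordP => i.
under eq_fun do rewrite mxE.
by apply: measurable_funM => //; exact: measurable_coord.
Qed.

(** By induction on d: the section of a dilated set at y is the dilation of the
    section at a *: y, so the one-dimensional case applies to each section and the
    induction hypothesis to the remaining integral. *)
Lemma lebesgue_rV_scale (R : realType) d (a : R) (A : set 'rV[R]_d) :
  (0 < a)%R -> measurable A ->
  lebesgue_rV d ((fun x => (a *: x)%R) @^-1` A) =
  (a^-1 ^+ d)%:E * lebesgue_rV d A.
Proof.
move=> a0; elim: d A => [|d ih] A mA.
  rewrite expr0 mul1e /=; congr (dirac _ _).
  by apply/seteqP; split => x /=; rewrite (_ : (a *: x)%R = x)//;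
    apply/rowP => -[].
pose B := @cons_rV R d @^-1` A.
have mB : measurable B.
  by rewrite -[X in measurable X]setTI; exact: measurable_cons_rV.
pose phi (y : 'rV[R]_d) := lebesgue_measure (ysection B y).
have mphi : measurable_fun setT phi.
  exact: (measurable_fun_ysection lebesgue_measure mB).
transitivity (\int[lebesgue_rV d]_y ((a^-1)%:E * phi (a *: y)%R)).
  rewrite /= /lebesgue_cons /pushforward /product_measure2.
  apply: eq_integral => y _ /=.
  rewrite -lebesgue_measure_scale//; last exact: measurable_ysection.
  congr (lebesgue_measure _); apply/seteqP; split => r /=;
    rewrite /ysection/= !inE /B/=; by rewrite cons_rVZ.
rewrite ge0_integralZl//; last 2 first.
- exact: (measurableT_comp mphi (@measurable_scale_rV R d a)).
- by rewrite lee_fin invr_ge0 ltW.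
have a0n : (0 <= a^-1 ^+ d)%R by rewrite exprn_ge0// invr_ge0 ltW.
rewrite exprS EFinM -muleA; congr (_ * _).
rewrite (@ge0_integral_image _ _ _ _ _ (lebesgue_rV d)
  (mscale (NngNum a0n) (lebesgue_rV d)) (fun y => (a *: y)%R) phi) //.
- by rewrite ge0_integral_mscale.
- exact: measurable_scale_rV.
Qed.

Lemma ge0_integral_rV_scale (R : realType) d (a : R) (g : 'rV[R]_d -> \bar R) :
  (0 < a)%R -> measurable_fun setT g -> (forall x, 0 <= g x) ->
  \int[lebesgue_rV d]_x g (a *: x)%R =
  (a^-1 ^+ d)%:E * \int[lebesgue_rV d]_x g x.
Proof.
move=> a0 mg g0.
have a0n : (0 <= a^-1 ^+ d)%R by rewrite exprn_ge0// invr_ge0 ltW.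
rewrite (@ge0_integral_image _ _ _ _ _ (lebesgue_rV d)
  (mscale (NngNum a0n) (lebesgue_rV d)) (fun y => (a *: y)%R) g) //.
- by rewrite ge0_integral_mscale.
- exact: measurable_scale_rV.
- by move=> A mA; exact: lebesgue_rV_scale.
Qed.

End change_of_variables.

(** * Tails of log-concave laws *)

Section exponential_moment.
Context {R : realType} {d : nat}.
Implicit Types (mu : probability 'rV[R]_d R) (f : 'rV[R]_d -> R).

Lemma measurable_norm2 : measurable_fun [set: 'rV[R]_d] (@norm2 R d).
Proof.
apply: (measurableT_comp (continuous_measurable_fun (@sqrt_continuous R))).
apply: measurable_sum => i.
by apply: measurable_funX; exact: measurable_coord.
Qed.

(** Since f (x / 2) <= f x / 2, the function exp (- f / 2) is below exp (- f)
    dilated by 2, and dilating multiplies the integral by 2^d. *)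
Lemma integral_expR_half_potential mu f : log_concave mu f -> f 0 = 0 ->
  (\int[mu]_x (expR (f x / 2))%:E <= (2 ^+ d)%:E)%E.
Proof.
move=> [cf [k k0 muE]] f0; have jf := convex_jensen cf.
have mf := measurable_jensen jf.
pose p x := k * expR (- f x).
have p0 x : 0 <= p x by rewrite mulr_ge0 ?expR_ge0// ltW.
have mexpNf : measurable_fun setT (fun x => expR (- f x)).
  by apply: measurableT_comp => //; exact: measurableT_comp.
have mp : measurable_fun setT p by exact: measurable_funM.
have mh : measurable_fun setT (fun x => (expR (f x / 2))%:E).
  apply/measurable_EFinP; apply: measurableT_comp => //.
  exact: measurable_funM.
have muE' A : measurable A -> mu A = (\int[lebesgue_rV d]_(x in A) (p x)%:E)%E.
  move=> mA; rewrite muE// -ge0_integralZl//.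
  - by apply/measurable_EFinP; exact: measurable_funTS.
  - by rewrite lee_fin ltW.
rewrite (@ge0_integral_density _ _ _ (lebesgue_rV d) mu _ _ mp p0 mh)//.
apply: (@le_trans _ _
    (\int[lebesgue_rV d]_x (p (2^-1 *: x))%:E)%E).
  apply: ge0_le_integral => //.
  - by move=> x _; rewrite mule_ge0// lee_fin ?expR_ge0.
  - by apply: emeasurable_funM => //; exact/measurable_EFinP.
  - apply/measurable_EFinP.
    exact: (measurableT_comp mp (@measurable_scale_rV R d _)).
  move=> x _; rewrite -EFinM lee_fin /p mulrCA ler_pM2l//.
  rewrite -expRD ler_expR.
  have := jf 2^-1 x 0; rewrite scaler0 addr0 f0 mulr0 addr0.
  rewrite invr_ge0 ler0n invf_le1// ler1n => /(_ isT isT) jx.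
  rewrite lerNr (le_trans jx)//.
  lra.
rewrite (@ge0_integral_rV_scale R d 2^-1 (fun x => (p x)%:E))//.
- by rewrite -muE'// probability_setT mule1 invrK.
- exact/measurable_EFinP.
Qed.

Lemma integral_expR_norm2 mu f (eta M : R) : 0 < eta -> 0 < M ->
  log_concave mu f -> f 0 = 0 -> tail_assumption eta M f 0 ->
  (\int[mu]_x (expR (eta / 2 * norm2 x))%:E <=
   (expR (eta * M / 2) * 2 ^+ d)%:E)%E.
Proof.
move=> eta0 M0 lc f0 [minf tailf].
have mf := measurable_jensen (convex_jensen lc.1).
(* Inside the ball of radius M the bound holds because f >= 0. *)
have bound x : eta * norm2 x <= f x + eta * M.
  have [/tailf|/ltW xM] := leP M (norm2 x).
    by rewrite f0 !subr0 => /le_trans; apply; rewrite lerDl mulr_ge0// ltW.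
  rewrite (@le_trans _ _ (eta * M))// ?ler_pM2l// lerDr.
  by rewrite -f0; exact: minf.
have mh : measurable_fun setT (fun x => (expR (f x / 2))%:E).
  apply/measurable_EFinP; apply: measurableT_comp => //.
  exact: measurable_funM.
apply: (@le_trans _ _
    (\int[mu]_x ((expR (eta * M / 2))%:E * (expR (f x / 2))%:E))%E).
  apply: ge0_le_integral => //.
  - apply/measurable_EFinP; apply: measurableT_comp => //.
    by apply: measurable_funM => //; exact: measurable_norm2.
  - exact: measurable_funeM.
  move=> x _; rewrite -EFinM lee_fin -expRD ler_expR.
  by have := bound x; lra.
rewrite ge0_integralZl ?lee_fin ?expR_ge0//.
rewrite EFinM lee_wpmul2l// ?lee_fin ?expR_ge0//.
exact: (integral_expR_half_potential lc f0).
Qed.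

(** Below a the first term suffices; above a, y^2 <= 2 a^2 + 2 (y - a)^2 and
    z^2 <= 4 exp z for z >= 0. *)
Lemma sqr_le_shifted_expR (a y : R) : 0 <= a -> 0 <= y ->
  y ^+ 2 <= 2 * a ^+ 2 + 8 * expR (y - a).
Proof.
move=> a0 y0; have e0 := expR_ge0 (y - a).
have [ya|/ltW ay] := leP y a.
  have : y ^+ 2 <= a ^+ 2 by rewrite ler_sqr.
  have : 0 <= a ^+ 2 by rewrite sqr_ge0.
  lra.
pose z := y - a; have z0 : 0 <= z by rewrite subr_ge0.
have ez : z ^+ 2 <= 4 * expR z.
  have zE : expR z = expR (z / 2) ^+ 2.
    by rewrite -expRM_natl; congr expR; field.
  have hz : z / 2 <= expR (z / 2).
    by rewrite (le_trans _ (expR_ge1Dx _))// lerDr.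
  have : (z / 2) ^+ 2 <= expR (z / 2) ^+ 2.
    by rewrite ler_sqr// ?nnegrE ?expR_ge0// divr_ge0.
  by rewrite -zE expr_div_n; lra.
have -> : y = a + z by rewrite /z addrC subrK.
rewrite [a + z - a]addrC addKr.
by have := sqr_ge0 (a - z); nra.
Qed.

(** A small piece rho of a law with an exponential moment has a second moment
    of the order of its mass times a squared logarithm.  The threshold a = ln K + L is
    chosen so that exp (- a) K = exp (- L), the contribution of the exponential,
    is at most the bound del on the mass. *)
Lemma integral_norm2_sqr_le (mu rho : {measure set 'rV[R]_d -> \bar R})
    (b K L del : R) : 0 < b -> 0 < K -> 0 <= ln K + L -> expR (- L) <= del ->
  (forall A, measurable A -> rho A <= mu A)%E -> (rho setT <= del%:E)%E ->
  (\int[mu]_x (expR (b * norm2 x))%:E <= K%:E)%E ->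
  (\int[rho]_x (norm2 x ^+ 2)%:E <=
   ((2 * (ln K + L) ^+ 2 + 8) / b ^+ 2 * del)%:E)%E.
Proof.
move=> b0 K0; set a := ln K + L => a0 Ldel rhomu rhoT expK.
pose c1 := 2 * a ^+ 2 / b ^+ 2; pose c2 := 8 * expR (- a) / b ^+ 2.
have b20 : 0 <= b ^- 2 by rewrite invr_ge0 sqr_ge0.
have c10 : 0 <= c1 by rewrite mulr_ge0// mulr_ge0// sqr_ge0.
have c20 : 0 <= c2 by rewrite mulr_ge0// mulr_ge0// expR_ge0.
have me : measurable_fun setT (fun x : 'rV[R]_d => (expR (b * norm2 x))%:E).
  apply/measurable_EFinP; apply: measurableT_comp => //.
  by apply: measurable_funM => //; exact: measurable_norm2.
have e0 x : (0 <= (expR (b * norm2 x))%:E)%E by rewrite lee_fin expR_ge0.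
apply: (@le_trans _ _ (\int[rho]_x (c1%:E + c2%:E * (expR (b * norm2 x))%:E))%E).
  apply: ge0_le_integral => //.
  - by move=> x _; rewrite lee_fin sqr_ge0.
  - by apply/measurable_EFinP; apply: measurable_funX; exact: measurable_norm2.
  - by apply: emeasurable_funD => //; exact: measurable_funeM.
  move=> x _; rewrite -EFinM -EFinD lee_fin.
  have -> : c1 + c2 * expR (b * norm2 x) =
      (2 * a ^+ 2 + 8 * expR (b * norm2 x - a)) / b ^+ 2.
    by rewrite expRD /c1 /c2; field; rewrite gt_eqF.
  rewrite ler_pdivlMr ?exprn_gt0// -exprMn mulrC.
  apply: sqr_le_shifted_expR => //.
  by rewrite mulr_ge0 ?sqrtr_ge0// ltW.
rewrite ge0_integralD//; last 2 first.
- by move=> x _; rewrite mule_ge0.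
- exact: measurable_funeM.
rewrite integral_cst// ge0_integralZl//.
apply: (@le_trans _ _ (c1%:E * del%:E + c2%:E * K%:E)%E).
  apply: leeD; first by rewrite lee_wpmul2l.
  rewrite lee_wpmul2l//; apply: le_trans expK.
  exact: ge0_le_measure_integral.
rewrite -!EFinM -EFinD lee_fin /c1 /c2.
have -> : expR (- a) = K^-1 * expR (- L).
  by rewrite /a opprD expRD [expR (- ln K)]expRN lnK ?posrE.
rewrite [leLHS](_ : _ = (2 * a ^+ 2 * del + 8 * expR (- L)) / b ^+ 2); last first.
  by field; rewrite !gt_eqF.
by rewrite [leRHS]mulrAC ler_wpM2r// [leRHS]mulrDl lerD2l ler_pM2l.
Qed.

End exponential_moment.

(** * Coupling along the common part *)

Section maximal_coupling.
Context {R : realType} {d : nat}.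
Implicit Types (mu nu : probability 'rV[R]_d R).

Lemma le_tv_dist mu nu (S : set 'rV[R]_d) : measurable S ->
  `|fine (mu S) - fine (nu S)| <= tv_dist mu nu.
Proof.
move=> mS; apply: ub_le_sup; last by exists S.
have fine01 (P : probability 'rV[R]_d R) A : measurable A ->
    0 <= fine (P A) <= 1.
  move=> mA; rewrite fine_ge0//= -lee_fin fineK ?probability_le1//.
  exact: fin_num_measure.
exists 1 => _ [A mA <-].
have /andP[? ?] := fine01 mu A mA; have /andP[? ?] := fine01 nu A mA.
by rewrite ler_norml; lra.
Qed.

(** With P, N a Hahn decomposition of mu - nu, the common part is nu on P and mu
    on N, and the rests are the Jordan parts of mu - nu; the mass of the first is
    mu P - nu P, one of the differences in the supremum defining tv_dist. *)
Lemma common_part mu nu :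
  exists (kap : {measure set 'rV[R]_d -> \bar R})
         (rho1 rho2 : {finite_measure set 'rV[R]_d -> \bar R}),
  [/\ forall A, measurable A -> mu A = (kap A + rho1 A)%E,
      forall A, measurable A -> nu A = (kap A + rho2 A)%E &
      (rho1 setT <= (tv_dist mu nu)%:E)%E].
Proof.
pose sg : {charge set 'rV[R]_d -> \bar R} :=
  cadd (charge_of_finite_measure mu) (cscale (-1) (charge_of_finite_measure nu)).
have [P [N hPN]] := Hahn_decomposition sg.
have [[mP _] [mN _] PUN PIN] := hPN.
have sgE A : sg A = (mu A - nu A)%E by rewrite /sg /= /cadd/= cscaleN1.
have posE A : measurable A ->
    jordan_pos hPN A = (mu (A `&` P) - nu (A `&` P))%E.
  move=> mA; rewrite jordan_posE cjordan_posE /crestr0 mem_set//= /crestr.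
  exact: sgE.
have negE A : measurable A ->
    jordan_neg hPN A = (nu (A `&` N) - mu (A `&` N))%E.
  move=> mA; rewrite jordan_negE cjordan_negE /crestr0 mem_set//= /crestr.
  rewrite [cadd _ _ _]sgE fin_num_oppeB ?fin_num_measure//; last exact: measurableI.
  by rewrite addeC.
have split (Q : probability 'rV[R]_d R) A : measurable A ->
    Q A = (Q (A `&` P) + Q (A `&` N))%E.
  move=> mA; rewrite -measureU//; [|exact: measurableI|exact: measurableI|].
    by rewrite -setIUr PUN setIT.
  by rewrite setIACA PIN setI0.
pose kap : {measure set 'rV[R]_d -> \bar R} :=
  measure_add (mrestr mu mN) (mrestr nu mP).
have kapE A : kap A = (mu (A `&` N) + nu (A `&` P))%E by exact: measure_addE.
have add3 (x y z : \bar R) : x \is a fin_num -> y \is a fin_num ->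
    z \is a fin_num -> (x + y = y + z + (x - z))%E.
  move=> /fineK <- /fineK <- /fineK <-.
  by rewrite -EFinB -!EFinD; congr EFin; ring.
exists kap, (jordan_pos hPN), (jordan_neg hPN); split => [A mA|A mA|].
- rewrite kapE [X in (_ + X)%E](posE A mA) split//.
  by apply: add3; apply: fin_num_measure; exact: measurableI.
- rewrite kapE [X in (_ + X)%E](negE A mA) split// addeC.
  rewrite [X in _ = (X + _)%E]addeC.
  by apply: add3; apply: fin_num_measure; exact: measurableI.
- rewrite [X in (X <= _)%E](posE _ measurableT) !setTI -(fineK (fin_num_measure mu P mP)).
  rewrite -(fineK (fin_num_measure nu P mP)) -EFinB lee_fin.
  exact: le_trans (ler_norm _) (le_tv_dist _ _ mP).
Qed.

Lemma common_part_mass mu nu (kap : {measure set 'rV[R]_d -> \bar R})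
    (rho1 rho2 : {finite_measure set 'rV[R]_d -> \bar R}) :
  (forall A, measurable A -> mu A = kap A + rho1 A)%E ->
  (forall A, measurable A -> nu A = kap A + rho2 A)%E ->
  rho1 setT = rho2 setT.
Proof.
move=> muE nuE.
have kfin : kap setT \is a fin_num.
  rewrite ge0_fin_numE// (le_lt_trans _ (ltry 1))//.
  by rewrite -(probability_setT mu) muE// leeDl.
have : (kap setT + rho1 setT = kap setT + rho2 setT)%E.
  by rewrite -muE// -nuE// !probability_setT.
by move/(congr1 (fun e => e - kap setT)%E); rewrite ![(kap _ + _)%E]addeC !addeK.
Qed.

(** The coupling leaves kap on the diagonal, where the cost vanishes, and sends
    rho1 to rho2 by their product divided by the common mass del. *)
Lemma W2_le_second_moments mu nu (kap : {measure set 'rV[R]_d -> \bar R})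
    (rho1 rho2 : {finite_measure set 'rV[R]_d -> \bar R}) (B : R) :
  (forall A, measurable A -> mu A = (kap A + rho1 A)%E) ->
  (forall A, measurable A -> nu A = (kap A + rho2 A)%E) ->
  (2%:E * \int[rho1]_x (norm2 x ^+ 2)%:E +
   2%:E * \int[rho2]_x (norm2 x ^+ 2)%:E <= B%:E)%E ->
  (W2 mu nu <= (Num.sqrt B)%:E)%E.
Proof.
move=> muE nuE leB.
have rhoTE := common_part_mass muE nuE.
pose del := fine (rho1 setT).
have del0 : 0 <= del by rewrite fine_ge0.
have delE : rho1 setT = del%:E by rewrite fineK// fin_num_measure.
have delV0 : 0 <= del^-1 by rewrite invr_ge0.
pose pi : {measure set ('rV[R]_d * 'rV[R]_d)%type -> \bar R} :=
  mscale (NngNum delV0) (rho1 \x rho2)%E.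
(* If del = 0 its inverse is 0 as well, and the identity reads 0 = 0. *)
have cancel_mass (rho : {finite_measure set 'rV[R]_d -> \bar R}) A :
    measurable A -> rho setT = del%:E -> (del^-1%:E * (rho A * del%:E) = rho A)%E.
  move=> mA rhoT; have [del_eq0|del_neq0] := eqVneq del 0.
    rewrite del_eq0 mule0 mule0; apply/esym/eqP.
    by rewrite eq_le measure_ge0 andbT -[leRHS]/(0%:E) -del_eq0 -rhoT le_measure ?inE.
  by rewrite muleCA -EFinM mulVf// mule1.
have pi1 A : measurable A -> pi (fst @^-1` A) = rho1 A.
  move=> mA; rewrite /pi /= /mscale/=.
  rewrite (_ : fst @^-1` A = A `*` setT); last first.
    by apply/seteqP; split => x /=; [|case].
  rewrite product_measure1E// -[RHS](cancel_mass _ _ mA delE).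
  by congr (_ * (_ * _))%E; rewrite -delE rhoTE.
have pi2 A : measurable A -> pi (snd @^-1` A) = rho2 A.
  move=> mA; rewrite /pi /= /mscale/=.
  rewrite (_ : snd @^-1` A = setT `*` A); last first.
    by apply/seteqP; split => x /=; [|case].
  have rho2T : rho2 setT = del%:E by rewrite -rhoTE.
  rewrite product_measure1E// -[RHS](cancel_mass _ _ mA rho2T).
  by rewrite [(rho2 A * _)%E]muleC -delE.
pose diag (x : 'rV[R]_d) := (x, x).
have mdiag : measurable_fun setT diag by exact: measurable_fun_pair.
pose kdiag : {measure set ('rV[R]_d * 'rV[R]_d)%type -> \bar R} :=
  measure_function_pushforward__canonical__measure_function_Measure kap mdiag.
pose phi0 : {measure set ('rV[R]_d * 'rV[R]_d)%type -> \bar R} :=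
  measure_add kdiag pi.
have phi0E A : phi0 A = (kap (diag @^-1` A) + pi A)%E by exact: measure_addE.
have phi0T : phi0 setT = 1%E.
  rewrite phi0E -[in pi _](preimage_setT fst) pi1//.
  exact: etrans (esym (muE _ measurableT)) (probability_setT mu).
pose phi : probability ('rV[R]_d * 'rV[R]_d)%type R :=
  HB.pack (Measure.sort phi0) (Measure_isProbability.Build _ _ _ _ phi0T).
have coup : coupling mu nu phi.
  move=> A mA; split.
    by rewrite [LHS]phi0E pi1// muE.
  by rewrite [LHS]phi0E pi2// nuE.
have mn2 : measurable_fun setT (fun x : 'rV[R]_d => (norm2 x ^+ 2)%:E).
  by apply/measurable_EFinP; apply: measurable_funX; exact: measurable_norm2.
have mcost : measurable_fun setT
    (fun z : ('rV[R]_d * 'rV[R]_d)%type => (norm2 (z.1 - z.2) ^+ 2)%:E).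
  apply: (measurableT_comp mn2); apply: measurable_fun_coordP => i.
  under eq_fun do rewrite !mxE.
  apply: measurable_funB.
    exact: (measurableT_comp (measurable_coord i) measurable_fst).
  exact: (measurableT_comp (measurable_coord i) measurable_snd).
have cost0 z : (0 <= (norm2 (z.1 - z.2 : 'rV[R]_d) ^+ 2)%:E)%E.
  by rewrite lee_fin sqr_ge0.
have n2E (x : 'rV[R]_d) : norm2 x ^+ 2 = \sum_(i < d) x ord0 i ^+ 2.
  by rewrite sqr_sqrtr// sumr_ge0// => i _; exact: sqr_ge0.
have costB : (\int[phi]_z (norm2 (z.1 - z.2) ^+ 2)%:E <= B%:E)%E.
  rewrite /phi /phi0 ge0_integral_measure_add//.
  rewrite -(@ge0_integral_image _ _ _ _ _ kap kdiag diag
    (fun z => (norm2 (z.1 - z.2) ^+ 2)%:E))//.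
  rewrite integral0_eq ?add0e; last first.
    move=> x _ /=; rewrite subrr n2E big1// => i _.
    by rewrite mxE expr0n.
  apply: le_trans leB.
  rewrite -(@ge0_integral_image _ _ _ _ _ pi rho1 fst _ measurable_fst pi1 mn2); last first.
    by move=> x; rewrite lee_fin sqr_ge0.
  rewrite -(@ge0_integral_image _ _ _ _ _ pi rho2 snd _ measurable_snd pi2 mn2); last first.
    by move=> x; rewrite lee_fin sqr_ge0.
  have m1 := measurableT_comp mn2 (@measurable_fst _ _ 'rV[R]_d 'rV[R]_d).
  have m2 := measurableT_comp mn2 (@measurable_snd _ _ 'rV[R]_d 'rV[R]_d).
  rewrite -!ge0_integralZl//; last 2 first.
  - by move=> z _; rewrite lee_fin sqr_ge0.
  - by move=> z _; rewrite lee_fin sqr_ge0.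
  rewrite -ge0_integralD//; last 4 first.
  - by move=> z _; rewrite mule_ge0// lee_fin sqr_ge0.
  - exact: measurable_funeM.
  - by move=> z _; rewrite mule_ge0// lee_fin sqr_ge0.
  - exact: measurable_funeM.
  apply: ge0_le_integral => //.
  - by apply: emeasurable_funD; exact: measurable_funeM.
  move=> [x y] _ /=; rewrite -!EFinM -EFinD lee_fin !n2E !mulr_sumr -big_split/=.
  apply: ler_sum => i _; rewrite !mxE.
  by have := sqr_ge0 (x ord0 i + y ord0 i); nra.
have B0 : 0 <= B.
  by rewrite -lee_fin; apply: le_trans costB; exact: integral_ge0.
rewrite /W2 -powR12_sqrt// -poweR_EFin.
apply: gt0_ler_poweR => //.
- rewrite in_itv/= leey andbT; apply: le_ereal_inf_tmp => _ [psi _ <-].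
  exact: integral_ge0.
- by rewrite in_itv/= lee_fin B0 leey.
- by apply: ge_ereal_inf; exists (\int[phi]_z (norm2 (z.1 - z.2) ^+ 2)%:E)%E => //; exists phi.
Qed.

End maximal_coupling.

(** * The transport bound *)

Unset Implicit Arguments.

Theorem lemma9 (R : realType) (eta M : R) (eta_gt0 : 0 < eta) (M_gt0 : 0 < M) :
  exists c : R,
    forall (d : nat) (mu nu : probability 'rV[R]_d R) (f g : 'rV[R]_d -> R),
      log_concave mu f -> log_concave nu g ->
      f 0 = 0 -> g 0 = 0 ->
      tail_assumption eta M f 0 -> tail_assumption eta M g 0 ->
      let tv := tv_dist mu nu in
      (W2 mu nu <=
       (if tv == 0 then 0
        else c * d%:R * Num.max (ln (1 / tv)) 1 * Num.sqrt tv)%:E)%E.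
Proof.
pose b := eta / 2; have b0 : 0 < b by rewrite divr_gt0.
pose m := eta * M / 2; have m0 : 0 < m by rewrite divr_gt0// mulr_gt0.
(* The square of the constant: twice two second moments, each bounded with
   a <= (m + 2) d L and 1 <= d L. *)
pose c2 := 4 * (2 * (m + 2) ^+ 2 + 8) / b ^+ 2.
have c20 : 0 <= c2.
  by rewrite divr_ge0 ?sqr_ge0// mulr_ge0// addr_ge0// mulr_ge0// sqr_ge0.
exists (Num.sqrt c2) => d mu nu f g lcf lcg f0 g0 tf tg.
cbv zeta; set tv := tv_dist mu nu.
have [kap [rho1 [rho2 [muE nuE rho1T]]]] := common_part mu nu.
have rho12 := common_part_mass muE nuE.
have rho2T : (rho2 setT <= tv%:E)%E by rewrite -rho12.
have tv0 : 0 <= tv by rewrite -lee_fin (le_trans _ rho1T).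
have rho_le (P : probability 'rV[R]_d R)
    (rho : {finite_measure set 'rV[R]_d -> \bar R}) :
    (forall A, measurable A -> P A = kap A + rho A)%E ->
    forall A, measurable A -> (rho A <= P A)%E.
  by move=> PE A mA; rewrite PE// leeDr.
(* Both laws are equal when tv = 0. *)
case: ifPn => [/eqP tv_eq0|tv_neq0].
  rewrite -[X in X%:E]sqrtr0; apply: (W2_le_second_moments muE nuE).
  have null (rho : {finite_measure set 'rV[R]_d -> \bar R}) :
      (rho setT <= tv%:E)%E -> (\int[rho]_x (norm2 x ^+ 2)%:E = 0)%E.
    rewrite tv_eq0 => rhoT.
    rewrite (@eq_measure_integral _ _ _ _ mzero) ?integral_measure_zero//.
    move=> A mA _; apply/eqP; rewrite eq_le measure_ge0 andbT.
    by rewrite (le_trans _ rhoT)// le_measure ?inE.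
  by rewrite !null// mule0 adde0.
have {}tv0 : 0 < tv by rewrite lt_neqAle eq_sym tv_neq0.
set L := Num.max _ _.
have L1 : 1 <= L by rewrite le_max lexx orbT.
have eL : expR (- L) <= tv.
  rewrite -[leRHS]lnK ?posrE// ler_expR lerNl -lnV ?posrE//.
  by rewrite /L div1r le_max lexx.
pose a := m + d%:R * ln 2 + L.
(* The bound on a by a multiple of d L below needs 1 <= d; the space is a single
   point when d = 0. *)
have [d0|dpos] := posnP d.
  subst d; rewrite mulr0 !mul0r -[X in X%:E]sqrtr0.
  apply: (W2_le_second_moments muE nuE).
  have norm2_0 (x : 'rV[R]_0) : norm2 x = 0 by rewrite /norm2 big_ord0 sqrtr0.
  by rewrite !integral0_eq ?mule0 ?adde0// => x _; rewrite norm2_0 expr0n.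
have d1 : 1 <= d%:R :> R by rewrite ler1n.
have ln2_ge0 : 0 <= ln 2 :> R by rewrite ln_ge0// ler1n.
have ln2_le1 : ln 2 <= 1 :> R.
  by have := @le_ln1Dx R 1 ltac:(lra); rewrite (_ : 1 + 1 = 2 :> R)//; ring.
pose K : R := expR m * 2 ^+ d.
have K0 : 0 < K by rewrite mulr_gt0 ?expR_gt0// exprn_gt0.
have lnK : ln K + L = a.
  by rewrite /a mulr_natl lnM ?posrE ?expR_gt0 ?exprn_gt0// expRK lnXn.
have L0 : 0 <= L by rewrite (le_trans _ L1).
have a0 : 0 <= a by rewrite !addr_ge0// ?mulr_ge0// ltW.
have a_le : a <= (m + 2) * (d%:R * L).
  have dL : 1 <= d%:R * L by rewrite mulr_ege1.
  have h1 : d%:R * ln 2 <= d%:R * L.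
    by rewrite ler_pM2l ?ltr0n// (le_trans ln2_le1).
  have h2 : L <= d%:R * L by rewrite ler_peMl.
  have h3 : m <= m * (d%:R * L) by rewrite ler_peMr// ltW.
  by rewrite /a mulrDl; lra.
have moment (P : probability 'rV[R]_d R) (h : 'rV[R]_d -> R)
    (rho : {finite_measure set 'rV[R]_d -> \bar R}) :
    log_concave P h -> h 0 = 0 -> tail_assumption eta M h 0 ->
    (forall A, measurable A -> P A = kap A + rho A)%E ->
    (rho setT <= tv%:E)%E ->
    (\int[rho]_x (norm2 x ^+ 2)%:E <= ((2 * a ^+ 2 + 8) / b ^+ 2 * tv)%:E)%E.
  move=> lch h0 th PE rhoT; rewrite -lnK.
  apply: (integral_norm2_sqr_le b0 K0 _ eL (rho_le _ _ PE) rhoT).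
    by rewrite lnK.
  exact: (integral_expR_norm2 eta_gt0 M_gt0 lch h0 th).
have LdT : 0 <= d%:R * L by rewrite mulr_ge0.
rewrite (_ : _ * _ = Num.sqrt (c2 * (d%:R * L) ^+ 2 * tv)); last first.
  rewrite (sqrtrM tv (mulr_ge0 c20 (sqr_ge0 _))) (sqrtrM _ c20).
  rewrite sqrtr_sqr ger0_norm//.
  by rewrite !mulrA.
apply: (W2_le_second_moments muE nuE).
apply: (@le_trans _ _ (2%:E * ((2 * a ^+ 2 + 8) / b ^+ 2 * tv)%:E +
                       2%:E * ((2 * a ^+ 2 + 8) / b ^+ 2 * tv)%:E)%E).
  apply: leeD; rewrite lee_wpmul2l ?lee_fin//.
    exact: (moment mu f).
  exact: (moment nu g).
rewrite -!EFinM -EFinD lee_fin mulrA mulrA -mulrDl ler_pM2r//.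
have a2 : a ^+ 2 <= ((m + 2) * (d%:R * L)) ^+ 2.
  by rewrite ler_sqr ?nnegrE// mulr_ge0// addr_ge0// ltW.
have dL2 : 1 <= (d%:R * L) ^+ 2 by rewrite exprn_ege1// mulr_ege1.
rewrite -mulrDl /c2 mulrAC ler_wpM2r ?invr_ge0 ?sqr_ge0//.
by move: a2; rewrite exprMn; nra.
Qed.
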